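(* There is an absolute constant $C>0$ such that the following holds. Fix $j\in\mathbb N$ and write $\phi=\phi_j$, $\lambda=\lambda_j$, and let $\Phi_0(x)=\int_0^x\phi(y)\,dy$. Then for all $0<x\le1$, $$|\Phi_0(x)|\le C\,|\lambda|^3x^3\min\Big\{\lambda^2,\,1+\log\tfrac1x\Big\}.$$
   Context: Let $K:[0,1]\times[0,1]\to\mathbb R$ be defined by $K(x,y)=\frac12-\{(xy)^{-1}\}$ if $0<x,y\le 1$, and $K(x,y)=0$ if $0\le x,y\le1$ and $xy=0$, where $\{\alpha\}=\alpha-\lfloor\alpha\rfloor$. Let $L^2([0,1])$ denote the space of real-valued Lebesgue measurable square-integrable functions on $[0,1]$, with $\langle f,g\rangle=\int_0^1 f(x)g(x)\,dx$ and $\|f\|=\langle f,f\rangle^{1/2}$. A function $\phi$ is an eigenfunction of $K$ (with eigenvalue $\lambda\in\mathbb R$) if $\phi\in L^2([0,1])$, $\|\phi\|>0$, and $\phi(x)=\lambda\int_0^1 K(x,y)\phi(y)\,dy$ for every $x\in[0,1]$. Let $\phi_1,\phi_2,\ldots$ be a maximal orthonormal system in $L^2([0,1])$ of eigenfunctions of $K$, $\phi_j$ having the nonzero real eigenvalue $\lambda_j$, numbered so that $0<|\lambda_1|\le|\lambda_2|\le\cdots$ and $\lambda_j\ge\lambda_{j+1}$ whenever $|\lambda_j|=|\lambda_{j+1}|$. *)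

(* Defs.v *)
From HB Require Import structures.
From mathcomp Require Import all_boot all_order all_algebra.
From mathcomp Require Import all_classical all_reals all_analysis.
Set Implicit Arguments. Unset Strict Implicit. Unset Printing Implicit Defensive.
Import Order.TTheory GRing.Theory Num.Theory.
Import numFieldNormedType.Exports.
Local Open Scope classical_set_scope.
Local Open Scope ring_scope.

Section Defs.
Variable R : realType.

Definition fracpart (a : R) : R := a - (Num.floor a)%:~R.

(* the kernel K on [0,1]^2 (value outside [0,1]^2 irrelevant) *)
Definition Kker (x y : R) : R :=
  if (0 < x) && (0 < y) then 2^-1 - fracpart ((x * y)^-1) else 0.

Definition I01 : set R := `[0%R, 1%R].

Definition integ (D : set R) (f : R -> R) : R :=
  Rintegral (@lebesgue_measure R) D f.

Definition L2 (f : R -> R) : Prop :=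
  measurable_fun I01 f /\
  (@lebesgue_measure R).-integrable I01 (fun x => (f x ^+ 2)%:E).

Definition ip (f g : R -> R) : R := integ I01 (fun x => f x * g x).

Definition L2norm (f : R -> R) : R := Num.sqrt (ip f f).

Definition eigenfun (phi : R -> R) (lam : R) : Prop :=
  L2 phi /\ 0 < L2norm phi /\
  forall x, I01 x -> phi x = lam * integ I01 (fun y => Kker x y * phi y).

Definition max_orth_eigensystem (phi : nat -> R -> R) (lam : nat -> R) : Prop :=
  (forall j, eigenfun (phi j) (lam j) /\ lam j != 0) /\
  (forall i j, ip (phi i) (phi j) = (i == j)%:R) /\
  (forall psi mu, eigenfun psi mu -> mu != 0 ->
     ~ (forall j, ip psi (phi j) = 0)) /\
  (forall j, 0 < `|lam j| /\ `|lam j| <= `|lam j.+1|) /\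
  (forall j, `|lam j| = `|lam j.+1| -> lam j.+1 <= lam j).

End Defs.

(* Main.v *)
Require Import Defs.
From HB Require Import structures.
From mathcomp Require Import all_boot all_order all_algebra.
From mathcomp Require Import all_classical all_reals all_analysis.
From mathcomp Require Import measurable_realfun ring lra.
Set Implicit Arguments. Unset Strict Implicit. Unset Printing Implicit Defensive.
Import Order.TTheory GRing.Theory Num.Theory.
Import numFieldNormedType.Exports.
Local Open Scope classical_set_scope.
Local Open Scope ring_scope.

(** Write K(x,y) = -B_1({1/(xy)}) and L = |lambda| >= 1; as ||phi|| = 1, the
    eigenvalue equation gives |phi| <= L/2.  If f is bounded and its primitive
    is at most A t^2 in absolute value, then integrating f against K(.,z) costs
    only the variation of K(.,z) weighted by t^2, so the result is at most
    13 A/z.  Since t^m B_m({1/(xt)}) has derivative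
    m t^(m-1) B_m({1/(xt)}) - m t^(m-2) B_{m-1}({1/(xt)})/x, the primitive of
    K(x,.) is O(x t^2) and that of t B_2({1/(xt)}) is O(x t^3).  Substituting
    phi = lambda K phi into itself therefore yields
    |phi(x)| <= C L^3 x (1 + log(1/x)).  For Phi_0, Fubini gives
    Phi_0(x) = lambda \int G(x,y) phi(y) dy with
    G(x,y) = x^2 y B_2({1/(xy)})/2 + O(x^3 y^2); substituting phi = lambda K phi
    once more bounds Phi_0(x) by C (L^3 x^3 + L^2 x^3 \int_x^1 |phi(z)| dz/z).
    The last integral is at most L log(1/x) by the trivial bound on phi, and at
    most C L^3 by the decay of phi at 0. *)

(** * Integrals of bounded measurable functions *)

Section bounded_measurable.
Context {R : realType}.
Notation mu := (@lebesgue_measure R).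
Implicit Types (D : set R) (f g : R -> R) (a b c t M : R).

(** A class closed under sums and products whose members are integrable on compact intervals; almost
    all integrability conditions below reduce to it. *)
Definition bmeas D f := measurable_fun D f /\ exists M, forall x, D x -> `|f x| <= M.

Lemma bmeas_cst D c : bmeas D (fun=> c).
Proof. by split; [exact: measurable_cst|exists `|c|]. Qed.

Lemma bmeas_add D f g : bmeas D f -> bmeas D g -> bmeas D (fun x => f x + g x).
Proof.
move=> [mf [M fM]] [mg [N gN]]; split; first exact: measurable_funD.
by exists (M + N) => x Dx; rewrite (le_trans (ler_normD _ _))// lerD ?fM ?gN.
Qed.

Lemma bmeas_mul D f g : bmeas D f -> bmeas D g -> bmeas D (fun x => f x * g x).
Proof.
move=> [mf [M fM]] [mg [N gN]]; split; first exact: measurable_funM.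
by exists (M * N) => x Dx; rewrite normrM ler_pM ?fM ?gN.
Qed.

Lemma bmeas_opp D f : bmeas D f -> bmeas D (fun x => - f x).
Proof.
move=> [mf [M fM]]; split; first exact: measurable_funN.
by exists M => x Dx; rewrite normrN fM.
Qed.

Lemma bmeas_norm D f : bmeas D f -> bmeas D (fun x => `|f x|).
Proof.
move=> [mf [M fM]]; split; first exact: measurableT_comp.
by exists M => x Dx; rewrite normr_id fM.
Qed.

Lemma bmeas_sum D (I : Type) (s : seq I) (F : I -> R -> R) :
  (forall i, bmeas D (F i)) -> bmeas D (fun x => \sum_(i <- s) F i x).
Proof.
move=> bF; elim: s => [|i s IH].
  by under eq_fun do rewrite big_nil; exact: bmeas_cst.
by under eq_fun do rewrite big_cons; exact: bmeas_add.
Qed.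

Lemma bmeas_sub D E f : measurable E -> D `<=` E -> bmeas E f -> bmeas D f.
Proof.
move=> mE DE [mf [M fM]]; split; first exact: measurable_funS mf.
by exists M => x /DE /fM.
Qed.

Lemma sub_itvcc a b a' b' : a <= a' -> b' <= b ->
  (`[a', b'] : set R) `<=` `[a, b].
Proof.
by move=> aa bb x /=; rewrite !in_itv/= => /andP[? ?]; apply/andP; split; lra.
Qed.

Lemma bmeas_itv a b a' b' f : a <= a' -> b' <= b ->
  bmeas `[a, b] f -> bmeas `[a', b'] f.
Proof. by move=> aa bb; apply: bmeas_sub => //; exact: sub_itvcc. Qed.

Lemma mu_itvcc_lty a b : (mu `[a, b]%classic < +oo)%E.
Proof. by rewrite lebesgue_measure_itv/=; case: ifP => // _; rewrite -EFinB ltry. Qed.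

Lemma bmeas_integrable a b f : bmeas `[a, b] f ->
  mu.-integrable `[a, b] (EFin \o f).
Proof.
move=> [mf [M fM]]; apply: measurable_bounded_integrable => //.
  exact: mu_itvcc_lty.
exists M; split; first exact: num_real.
by move=> N MN x Dx; apply: le_trans (fM _ Dx) _; exact: ltW.
Qed.

Lemma integ_cst a b c : a <= b -> integ `[a, b] (fun=> c) = c * (b - a).
Proof.
move=> ab; rewrite /integ Rintegral_cst//= lebesgue_measure_itv/= lte_fin.
move: ab; rewrite le_eqVlt => /predU1P[->|ab]; first by rewrite ltxx subrr.
by rewrite ab.
Qed.

Lemma eq_integ D f g : (forall x, D x -> f x = g x) -> integ D f = integ D g.
Proof. by move=> fg; apply: eq_Rintegral => x /set_mem; exact: fg. Qed.

Lemma integ_add a b f g : bmeas `[a, b] f -> bmeas `[a, b] g ->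
  integ `[a, b] (fun x => f x + g x) = integ `[a, b] f + integ `[a, b] g.
Proof. by move=> bf bg; apply: RintegralD => //; exact: bmeas_integrable. Qed.

Lemma integ_sub a b f g : bmeas `[a, b] f -> bmeas `[a, b] g ->
  integ `[a, b] (fun x => f x - g x) = integ `[a, b] f - integ `[a, b] g.
Proof. by move=> bf bg; apply: RintegralB => //; exact: bmeas_integrable. Qed.

Lemma integ_scale a b c f : bmeas `[a, b] f ->
  integ `[a, b] (fun x => c * f x) = c * integ `[a, b] f.
Proof. by move=> bf; apply: RintegralZl => //; exact: bmeas_integrable. Qed.

Lemma integ_sum a b (I : Type) (s : seq I) (F : I -> R -> R) :
  (forall i, bmeas `[a, b] (F i)) ->
  integ `[a, b] (fun x => \sum_(i <- s) F i x) = \sum_(i <- s) integ `[a, b] (F i).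
Proof.
move=> bF; elim: s => [|i s IH].
  rewrite big_nil (@eq_integ _ _ (fun=> 0)); last by move=> x _; rewrite big_nil.
  by rewrite /integ Rintegral_cst// mul0r.
rewrite big_cons -IH -integ_add//; last exact: bmeas_sum.
by apply: eq_integ => x _; rewrite big_cons.
Qed.

Lemma le_integ a b f g : bmeas `[a, b] f -> bmeas `[a, b] g ->
  (forall x, a <= x -> x <= b -> f x <= g x) -> integ `[a, b] f <= integ `[a, b] g.
Proof.
move=> bf bg fg; apply: le_Rintegral => //; [exact: bmeas_integrable..|].
by move=> x /=; rewrite in_itv/= => /andP[]; exact: fg.
Qed.

Lemma norm_integ_le a b f g : bmeas `[a, b] f -> bmeas `[a, b] g ->
  (forall x, a <= x -> x <= b -> `|f x| <= g x) ->
  `|integ `[a, b] f| <= integ `[a, b] g.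
Proof.
move=> bf bg fg; apply: (@le_trans _ _ (integ `[a, b] (fun x => `|f x|))).
  by apply: le_normr_Rintegral => //; exact: bmeas_integrable.
by apply: le_integ => //; exact: bmeas_norm.
Qed.

Lemma norm_integ_le_cst a b f M : a <= b -> measurable_fun (`[a, b] : set R) f ->
  (forall x, a <= x -> x <= b -> `|f x| <= M) -> `|integ `[a, b] f| <= M * (b - a).
Proof.
move=> ab mf fM; rewrite -integ_cst//; apply: norm_integ_le => //.
  by split=> //; exists M => x /=; rewrite in_itv/= => /andP[]; exact: fM.
exact: bmeas_cst.
Qed.

Lemma integ_split a b c f : a <= b -> b <= c -> bmeas `[a, c] f ->
  integ `[a, c] f = integ `[a, b] f + integ `[b, c] f.
Proof.
move=> ab bc bf; have /bmeas_integrable bfi := bf.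
have := @Rintegral_itvB R f (BLeft a) (BRight c) b bfi.
rewrite !bnd_simp => /(_ ab bc).
rewrite /integ Rintegral_itv_obnd_cbnd => [<-|]; first by ring.
apply: integrableS (bmeas_integrable _) => //; last exact: (bmeas_itv ab _ bf).
exact: subset_itv_oc_cc.
Qed.

(** Carrying the upper limit as an indicator turns integrals over a triangle into integrals over a
    rectangle, where Fubini applies. *)
Lemma integ_restrict a b c f : c <= b ->
  integ `[a, b] (fun x => (x <= c)%R%:R * f x) = integ `[a, c] f.
Proof.
move=> cb.
have -> : (`[a, c] = `[a, b] `&` [set x | x <= c])%classic.
  apply/seteqP; split => x /=; rewrite !in_itv/=.
    by move=> /andP[-> xc]; split => //=; apply: le_trans xc _.
  by move=> [/andP[-> _] ->].
rewrite /integ Rintegral_mkcondr; apply: eq_integ => x _.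
rewrite patchE; case: ifPn => [/set_mem/= ->|]; first by rewrite mul1r.
by rewrite notin_setE/= => /negP/negbTE ->; rewrite mul0r.
Qed.

End bounded_measurable.

(** * Fubini's theorem for bounded measurable functions on a rectangle *)

Section fubini.
Context {R : realType}.
Notation mR := (measurableTypeR R).
Notation mu := (@lebesgue_measure R).
Variables (a b c d M : R) (g : R -> R -> R).
Hypothesis mg : measurable_fun setT (fun p : mR * mR => g p.1 p.2).
Hypothesis gM : forall x y, a <= x -> x <= b -> c <= y -> y <= d -> `|g x y| <= M.

Let D : set (mR * mR) := `[a, b] `*` `[c, d].
(** Extension by zero, because the product integral is taken over the whole plane. *)
Let h : mR * mR -> \bar R := (fun p => (g p.1 p.2)%:E) \_ D.

Let mD : measurable D.
Proof. exact: measurableX. Qed.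

Let ih : (mu \x mu)%E.-integrable setT h.
Proof.
apply: (integrable_mkcond _ mD).1.
apply: (@measurable_bounded_integrable _ _ _ _ (fun p : mR * mR => g p.1 p.2)) => //.
- apply: (@le_lt_trans _ _ (mu `[a, b]%classic * mu `[c, d]%classic)%E).
    by rewrite le_eqVlt; apply/orP; left; apply/eqP; exact: product_measure1E.
  by apply: lte_mul_pinfty; rewrite ?ge0_fin_numE ?mu_itvcc_lty.
- exact: measurable_funTS.
- exists M; split; first exact: num_real.
  move=> N MN [x y] [] /=; rewrite !in_itv/= => /andP[? ?] /andP[? ?].
  by apply: le_trans (ltW MN); exact: gM.
Qed.

Lemma bmeas_sectionl x : a <= x -> x <= b -> bmeas `[c, d] (g x).
Proof.
move=> ax xb; split; last first.
  by exists M => y /=; rewrite in_itv/= => /andP[]; exact: gM.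
apply: measurable_funTS.
exact: (measurableT_comp mg (pair1_measurable x)).
Qed.

Let sectionE x : (\int[mu]_y h (x, y))%E =
  ((EFin \o (fun x => integ `[c, d] (g x))) \_ `[a, b]) x.
Proof.
rewrite patchE; case: ifPn => [/set_mem/=|].
  rewrite in_itv/= => /andP[ax xb]; rewrite /integ /Rintegral fineK; last first.
    exact: (integrable_fin_num _ (bmeas_integrable (bmeas_sectionl ax xb))).
  rewrite [RHS]integral_mkcond; apply: eq_integral => y _.
  rewrite /h !patchE; congr (if _ then _ else _).
  apply/idP/idP => [/set_mem[_ /= cd]|/set_mem cd]; apply/mem_set => //.
  by split => //=; rewrite in_itv/= ax.
rewrite notin_setE/= => xab; rewrite (eq_integral (cst 0%E)) ?integral0// => y _.
by rewrite /h patchE ifF//; apply/negP => /set_mem[].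
Qed.

Lemma bmeas_integ : bmeas `[a, b] (fun x => integ `[c, d] (g x)).
Proof.
split; last first.
  (* The absolute values cover [d < c], where the integral is over the empty set and [d - c] is
     negative. *)
  exists (`|M| * `|d - c|) => x /=; rewrite in_itv/= => /andP[ax xb].
  have [cd|dc] := leP c d; last first.
    by rewrite /integ set_itv_ge ?bnd_simp -?ltNge// Rintegral_set0 normr0 mulr_ge0.
  rewrite [X in _ * X]ger0_norm; last by rewrite subr_ge0.
  apply: norm_integ_le_cst => //; first by case: (bmeas_sectionl ax xb).
  by move=> y cy yd; apply: le_trans (gM _ _ _ _) (ler_norm _).
have := measurable_fubini_F ih.
rewrite /fubini_F (_ : (fun x => _) =
  ((EFin \o (fun x => integ `[c, d] (g x))) \_ `[a, b])); last first.
  by apply/funext => x; rewrite sectionE.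
by move/(measurable_restrictT _ (measurable_itv _)).2/measurable_EFinP.
Qed.

Lemma integ_productE : (integ `[a, b] (fun x => integ `[c, d] (g x)))%:E =
  (\int[mu]_x \int[mu]_y
    ((fun p : mR * mR => (g p.1 p.2)%:E) \_ (`[a, b] `*` `[c, d])) (x, y))%E.
Proof.
under [RHS]eq_integral do rewrite sectionE.
rewrite -integral_mkcond /integ [in LHS]/Rintegral fineK//.
exact: (integrable_fin_num _ (bmeas_integrable bmeas_integ)).
Qed.

Lemma integrable_product : (mu \x mu)%E.-integrable setT
  ((fun p : mR * mR => (g p.1 p.2)%:E) \_ (`[a, b] `*` `[c, d])).
Proof. exact: ih. Qed.

End fubini.

Lemma integ_fubini (R : realType) (a b c d M : R) (g : R -> R -> R) :
  measurable_fun setT (fun p : measurableTypeR R * measurableTypeR R => g p.1 p.2) ->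
  (forall x y, a <= x -> x <= b -> c <= y -> y <= d -> `|g x y| <= M) ->
  integ `[a, b] (fun x => integ `[c, d] (g x)) =
  integ `[c, d] (fun y => integ `[a, b] (fun x => g x y)).
Proof.
move=> mg gM.
have mg' : measurable_fun setT
    (fun p : measurableTypeR R * measurableTypeR R => g p.2 p.1).
  exact: (measurableT_comp mg (@measurable_swap _ _ _ _)).
apply: EFin_inj; rewrite (integ_productE mg gM).
rewrite (@integ_productE _ c d a b M (fun y x => g x y))//; last first.
  by move=> y x *; exact: gM.
rewrite (Fubini (integrable_product mg gM)); apply: eq_integral => y _.
apply: eq_integral => x _; rewrite !patchE; congr (if _ then _ else _).
by apply/idP/idP => /set_mem[/= A B]; apply/mem_set.
Qed.

(** * Measurability of the floor and of the inverse *)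

Section measurability.
Context {R : realType}.

(** Closed upper rays generate the Borel sets, and floor pulls the ray from y back to the ray from
    the ceiling of y. *)
Lemma measurable_floor : measurable_fun setT (fun x : R => (Num.floor x)%:~R : R).
Proof.
move=> _; apply: (measurability _ (RGenCInfty.measurableE R)) => //.
move=> /= _ [_ [y ->] <-]; rewrite setTI.
rewrite (_ : _ @^-1` _ = `[(Num.ceil y)%:~R, +oo[%classic) //.
apply/seteqP; split => x /=; rewrite !in_itv/= !andbT.
  by move=> yx; rewrite -floor_ge_int ceil_le_int.
by move=> yx; rewrite -ceil_le_int floor_ge_int.
Qed.

(** The inverse is continuous on the open set of nonzero reals, and the remaining set is a single
    point. *)
Lemma measurable_inv : measurable_fun setT (fun x : R => x^-1).
Proof.
rewrite (_ : setT = [set x : R | x != 0] `|` [set 0]); last first.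
  by apply/seteqP; split => // x _; case: (eqVneq x 0) => [->|x0]; [right|left].
have o0 : open [set x : R | x != 0] by exact: open_neq.
apply/measurable_funU => //; first exact: open_measurable.
split; last exact: measurable_fun_set1.
apply: open_continuous_measurable_fun => // x /set_mem/= x0.
exact: inv_continuous.
Qed.

End measurability.

(** * The kernel and periodic Bernoulli functions *)

Section fractional_part.
Context {R : realType}.
Notation mR := (measurableTypeR R).
Implicit Types (x y : R).

Lemma fracpart_ge0 x : 0 <= fracpart x.
Proof. by rewrite /fracpart subr_ge0 floor_le. Qed.

Lemma fracpart_lt1 x : fracpart x < 1.
Proof. by rewrite /fracpart ltrBlDl -intrD1 floorD1_gt. Qed.

Lemma fracpart_nat (n : nat) x : n%:R <= x -> x < n.+1%:R -> fracpart x = x - n%:R.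
Proof.
move=> nx xn; rewrite /fracpart (@floor_def _ _ n%:Z)//.
by rewrite -natr1 in xn; rewrite intrD1; apply/andP.
Qed.

(** As [0^-1 = 0], this vanishes when [x * y = 0]. There [2^-1 - frac_inv x y] is 1/2 while
    [Kker x y] is 0, so the two agree on the unit square only at positive arguments. *)
Definition frac_inv x y : R := fracpart ((x * y)^-1).

Lemma frac_invC x y : frac_inv x y = frac_inv y x.
Proof. by rewrite /frac_inv mulrC. Qed.

Lemma Kker_pos x y : 0 < x -> 0 < y -> Kker x y = 2^-1 - frac_inv x y.
Proof. by move=> x0 y0; rewrite /Kker x0 y0. Qed.

Lemma KkerC x y : Kker x y = Kker y x.
Proof. by rewrite /Kker andbC mulrC. Qed.

Lemma Kker_norm x y : `|Kker x y| <= 2^-1.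
Proof.
rewrite /Kker; case: ifP => _; last by rewrite normr0; lra.
have := fracpart_ge0 ((x * y)^-1); have := fracpart_lt1 ((x * y)^-1).
by rewrite ler_norml => ? ?; lra.
Qed.

Lemma measurable_mul2 : measurable_fun setT (fun p : mR * mR => p.1 * p.2 : R).
Proof. by apply: measurable_funM; [exact: measurable_fst|exact: measurable_snd]. Qed.

Lemma measurable_frac_inv2 :
  measurable_fun setT (fun p : mR * mR => frac_inv p.1 p.2).
Proof.
have minv : measurable_fun setT (fun p : mR * mR => (p.1 * p.2)^-1 : R).
  exact: (measurableT_comp measurable_inv measurable_mul2).
rewrite /frac_inv /fracpart; apply: measurable_funB => //.
exact: (measurableT_comp measurable_floor minv).
Qed.

Lemma measurable_Kker2 : measurable_fun setT (fun p : mR * mR => Kker p.1 p.2 : R).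
Proof.
rewrite /Kker; apply: measurable_fun_if => //.
- apply: measurable_and; apply: measurable_fun_ltr => //; exact: measurable_cst.
- apply: measurable_funTS; apply: measurable_funB => //; exact: measurable_frac_inv2.
Qed.

Lemma measurable_sectionl (g : R -> R -> R) x :
  measurable_fun setT (fun p : mR * mR => g p.1 p.2) -> measurable_fun setT (g x).
Proof. by move=> mg; exact: (measurableT_comp mg (pair1_measurable x)). Qed.

End fractional_part.

Lemma ler_add_natV (R : realType) (z w C : R) (n0 : nat) :
  (forall n, (n0 <= n)%N -> z <= w + C / n.+1%:R) -> z <= w.
Proof.
move=> h; apply/ler_addgt0Pr => e e0.
pose n := maxn n0 (Num.truncn (`|C| / e)).
apply: le_trans (h n (leq_maxl _ _)) _; rewrite lerD2l.
rewrite ler_pdivrMr ?ltr0Sn// mulrC -ler_pdivrMr//.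
apply: (@le_trans _ _ (`|C| / e)); first by rewrite ler_pM2r ?invr_gt0// ler_norm.
apply/ltW/(lt_le_trans (truncnS_gt _)).
by rewrite ler_nat ltnS leq_maxr.
Qed.

Lemma integ_ftc (R : realType) (f F : R -> R) (a b : R) : a <= b ->
  (forall y, a <= y -> y <= b -> is_derive y 1 F (f y)) ->
  (forall y, a <= y -> y <= b -> {for y, continuous f}) ->
  integ `[a, b] f = F b - F a.
Proof.
rewrite le_eqVlt => /predU1P[-> _ _|ab dF cf].
  by rewrite /integ set_itv1 Rintegral_set1 subrr.
have cF y : a <= y -> y <= b -> {for y, continuous F}.
  move=> ay yb; apply: differentiable_continuous.
  by apply/derivable1_diffP; case: (dF _ ay yb).
rewrite /integ /Rintegral (@continuous_FTC2 _ f F a b ab) //.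
- apply: continuous_in_subspaceT => y /set_mem/=; rewrite in_itv/= => /andP[? ?].
  exact: cf.
- split.
  + move=> y; rewrite in_itv/= => /andP[/ltW ay /ltW yb].
    by case: (dF _ ay yb).
  + by apply: cvg_at_right_filter; apply: cF => //; exact: ltW.
  + by apply: cvg_at_left_filter; apply: cF => //; exact: ltW.
- move=> y; rewrite in_itv/= => /andP[/ltW ay /ltW yb].
  by rewrite derive1E; have := dF _ ay yb => /@derive_val ->.
Qed.

(** * Primitives of the form y^m B({1/(xy)}) *)

Section periodic_primitive.
Context {R : realType}.
Variables (x M : R) (p : nat) (B b : R -> R).
Hypotheses (x_gt0 : 0 < x) (x_le1 : x <= 1).
Hypothesis dB : forall u : R, is_derive u 1 B (b u).
Hypothesis cb : continuous b.
Hypothesis B01 : B 0 = B 1.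
Hypothesis BM : forall u, 0 <= u -> u <= 1 -> `|B u| <= M.
Hypothesis bM : forall u, 0 <= u -> u <= 1 -> `|b u| <= M.

Let cB : continuous B.
Proof.
move=> u; apply: differentiable_continuous.
by apply/derivable1_diffP; case: (dB u).
Qed.

(** [q] is the derivative of [Q] wherever 1/(xy) is not an integer. The exponent [p.+2] absorbs the
    factor 1/(x y^2) from the inner derivative, so that [q] stays bounded near 0. *)
Let q y := p.+2%:R * y ^+ p.+1 * B (frac_inv x y) - y ^+ p * b (frac_inv x y) / x.
Let Q y := y ^+ p.+2 * B (frac_inv x y).

Let mq : measurable_fun setT q.
Proof.
have mB (C : R -> R) : continuous C -> measurable_fun setT (fun y => C (frac_inv x y)).
  move=> cC; apply: (measurableT_comp (continuous_measurable_fun cC)).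
  exact: (measurable_sectionl _ measurable_frac_inv2).
apply: measurable_funB; apply: measurable_funM => //.
- by apply: measurable_funM => //; exact: exprn_measurable.
- exact: mB.
- by apply: measurable_funM; [exact: exprn_measurable|exact: mB].
Qed.

Let frac01 y : 0 <= frac_inv x y <= 1.
Proof. by rewrite fracpart_ge0 ltW// fracpart_lt1. Qed.

Let N := p.+2%:R * M + M / x.

Let qN y : 0 <= y -> y <= 1 -> `|q y| <= N.
Proof.
move=> y0 y1; have /andP[u0 u1] := frac01 y.
apply: le_trans (ler_normB _ _) _; rewrite lerD// !normrM normrX (ger0_norm y0).
  rewrite normr_nat -mulrA ler_pM2l ?ltr0Sn//.
  by rewrite -[leRHS]mul1r ler_pM ?exprn_ge0 ?exprn_ile1 ?BM.
rewrite normfV (gtr0_norm x_gt0) ler_pM2r ?invr_gt0//.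
by rewrite -[leRHS]mul1r ler_pM ?bM ?exprn_ge0 ?exprn_ile1.
Qed.

Let bq a t : 0 <= a -> t <= 1 -> bmeas `[a, t] q.
Proof.
move=> a0 t1; split; first exact: measurable_funTS.
exists N => y /=; rewrite in_itv/= => /andP[ay yt]; apply: qN; lra.
Qed.

(** On the branch where the floor of 1/(xy) is n, [q] and [Q] coincide with [q_ n] and [Q_ n], which
    are smooth enough for the fundamental theorem on all of y > 0. *)
Let q_ n y := p.+2%:R * y ^+ p.+1 * B ((x * y)^-1 - n%:R)
  - y ^+ p * b ((x * y)^-1 - n%:R) / x.
Let Q_ n y := y ^+ p.+2 * B ((x * y)^-1 - n%:R).

Let dQ (n : nat) (y : R) : 0 < y -> is_derive y 1 (Q_ n) (q_ n y).
Proof.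
move=> y0; have xy0 : x * y != 0 by rewrite mulf_neq0// gt_eqF.
have dg : is_derive y 1 (fun y : R => (x * y)^-1 - n%:R) (- (x * y ^+ 2)^-1).
  have dxy : is_derive y 1 (fun y : R => x * y) x.
    by apply: is_derive_eq; rewrite /GRing.scale/= mulr1.
  have dV := is_deriveV xy0 dxy.
  apply: is_derive_eq; rewrite /GRing.scale/=; field.
  by rewrite !gt_eqF.
have dBg := @is_derive1_comp _ B _ y _ _ (dB _) dg.
have -> : Q_ n = id ^+ p.+2 * (B \o (fun y : R => (x * y)^-1 - n%:R)).
  by apply/funext => z; rewrite /Q_ !fctE.
apply: is_derive_eq; rewrite /q_ /GRing.scale/= exprfctE; rewrite ?fctE ?exprSr; field.
by rewrite !gt_eqF.
Qed.

Let cq (n : nat) (y : R) : 0 < y -> {for y, continuous (q_ n)}.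
Proof.
move=> y0; have xy0 : x * y != 0 by rewrite mulf_neq0// gt_eqF.
have cg : {for y, continuous (fun y : R => (x * y)^-1 - n%:R)}.
  apply: continuousB; last exact: cst_continuous.
  by apply: continuousV => //; exact: mulrl_continuous.
have cC (C : R -> R) : continuous C ->
    {for y, continuous (fun y : R => C ((x * y)^-1 - n%:R))}.
  move=> cC; apply: (@continuous_comp _ _ _ (fun y : R => (x * y)^-1 - n%:R) C) => //.
  exact: cC.
apply: continuousB; apply: continuousM.
- apply: continuousM; first exact: cst_continuous.
  exact: exprn_continuous.
- exact: cC.
- by apply: continuousM; [exact: exprn_continuous|exact: cC].
- exact: cst_continuous.
Qed.

(* On [a, t] the floor of 1/(xy) is n, except possibly at y = a, where B 0 = B 1 keeps Q
   continuous. *)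
Let piece (n : nat) (a t : R) : 0 < a -> a <= t -> t <= 1 ->
  n%:R <= (x * t)^-1 -> (x * a)^-1 <= n.+1%:R -> integ `[a, t] q = Q t - Q a.
Proof.
move=> a0 + t1 nt na; rewrite le_eqVlt => /predU1P[->|at_].
  by rewrite /integ set_itv1 Rintegral_set1 subrr.
have t0 : 0 < t by lra.
have nle y : a < y -> y <= t -> n%:R <= (x * y)^-1.
  move=> ay yt; apply: le_trans nt _.
  by rewrite lef_pV2 ?posrE ?mulr_gt0 ?ler_pM2l//; lra.
have lta y : a < y -> y <= t -> (x * y)^-1 < (x * a)^-1.
  by move=> ay yt; rewrite ltf_pV2 ?posrE ?mulr_gt0 ?ltr_pM2l//; lra.
have fracE y : a < y -> y <= t -> frac_inv x y = (x * y)^-1 - n%:R.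
  move=> ay yt; apply: fracpart_nat; first exact: nle.
  exact: lt_le_trans (lta _ ay yt) na.
have qE y : `]a, t]%classic y -> q y = q_ n y.
  by move=> /=; rewrite in_itv/= => /andP[ay yt]; rewrite /q /q_ fracE.
(* [q] and [q_ n] may differ at [a], so the integrals are compared on the half-open interval. *)
have iq : (@lebesgue_measure R).-integrable `]a, t] (EFin \o q).
  by apply: integrableS (bmeas_integrable (bq (ltW a0) t1)) => //; exact: subset_itv_oc_cc.
have iq_ : (@lebesgue_measure R).-integrable `]a, t] (EFin \o q_ n).
  by apply: eq_integrable iq => // y /set_mem/qE /= ->.
rewrite /integ -Rintegral_itv_obnd_cbnd// -/(integ _ _) (eq_integ qE).
rewrite /integ Rintegral_itv_obnd_cbnd// -/(integ _ _).
have -> : integ `[a, t] (q_ n) = Q_ n t - Q_ n a.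
  apply: integ_ftc; [exact: ltW|by move=> y ay yt; apply: dQ; lra|].
  by move=> y ay yt; apply: cq; lra.
rewrite /Q_ /Q fracE//; congr (_ - _ * _).
(* If 1/(xa) = n+1, the fractional part at [a] is 0 while the branch takes the value 1. *)
move: na; rewrite le_eqVlt => /predU1P[na|na].
  rewrite /frac_inv na (@fracpart_nat _ n.+1) ?ltr_nat// subrr B01.
  by congr B; rewrite -natr1; ring.
rewrite /frac_inv (@fracpart_nat _ n) => //.
by apply/ltW/(le_lt_trans nt); exact: lta.
Qed.

(** The points 1/(x(n+1)) cut []0, t]] into branches, over which the increments of [Q] telescope.
    What is left near 0 tends to 0. *)
Lemma integ_periodic (t : R) : 0 < t -> t <= 1 -> integ `[0, t] q = Q t.
Proof.
move=> t0 t1; pose a_ (n : nat) := (x * n.+1%:R)^-1.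
have a_gt0 n : 0 < a_ n by rewrite invr_gt0 mulr_gt0 ?ltr0Sn.
have xa n : (x * a_ n)^-1 = n.+1%:R.
  by rewrite /a_ invfM invrK mulKf ?gt_eqF.
have a_decr n : a_ n.+1 <= a_ n.
  by rewrite lef_pV2 ?posrE ?mulr_gt0 ?ltr0Sn// ler_pM2l// ler_nat.
pose n0 := Num.truncn (x * t)^-1.
have xt0 : 0 < (x * t)^-1 by rewrite invr_gt0 mulr_gt0.
have /andP[n0t tn0] := truncn_itv (ltW xt0).
have n0_gt0 : (0 < n0)%N.
  by rewrite truncn_gt0 invf_ge1 ?mulr_gt0// mulr_ile1// ltW.
(* The floor of 1/(xy) is [n0] between [a_ n0] and [t], and then increases by one on each interval
   from [a_ n.+1] to [a_ n]. *)
have step m : a_ (n0 + m)%N <= t /\ integ `[a_ (n0 + m)%N, t] q = Q t - Q (a_ (n0 + m)%N).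
  elim: m => [|m [IH1 IH2]].
    rewrite addn0; have at_ : a_ n0 <= t.
      rewrite -[leRHS]mul1r -(mulVf (lt0r_neq0 x_gt0)) -mulrA.
      by rewrite /a_ invfM ler_pM2l ?invr_gt0// invf_ple ?posrE ?ltr0Sn ?mulr_gt0// ltW.
    by split => //; apply: (@piece n0) => //; rewrite xa.
  rewrite addnS; have le_ := le_trans (a_decr (n0 + m)%N) IH1.
  split => //; rewrite (@integ_split _ _ (a_ (n0 + m)%N))//; last first.
    by apply: bq => //; exact: ltW.
  rewrite IH2 (@piece (n0 + m).+1)//; first by ring.
  - exact: le_trans t1.
  - by rewrite xa.
  - by rewrite xa.
apply/eqP; rewrite -subr_eq0 -normr_le0.
(* On [[0, a_ n]] the integral of [q] is at most N a_n, and |Q(a_n)| is at most M a_n, with a_n =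
   1/(x(n+1)). *)
apply: (@ler_add_natV _ _ _ ((N + M) / x) n0) => n n0n; rewrite add0r.
have [an_le In] := step (n - n0)%N; rewrite subnKC// in an_le In.
rewrite (@integ_split _ _ (a_ n))//; [|exact: ltW|exact: bq].
rewrite In (_ : _ - _ = integ `[0, a_ n] q - Q (a_ n)); last by ring.
apply: le_trans (ler_normB _ _) _.
have an1 : a_ n <= 1 by apply: le_trans t1.
have -> : (N + M) / x / n.+1%:R = N * a_ n + a_ n * M.
  by rewrite /a_; field; rewrite !gt_eqF.
apply: lerD.
  rewrite -[X in _ * X]subr0; apply: norm_integ_le_cst; first exact: ltW.
    exact: measurable_funTS.
  by move=> y y0 ya; apply: qN => //; exact: le_trans an1.
have /andP[u0 u1] := frac01 (a_ n).
rewrite normrM normrX (gtr0_norm (a_gt0 n)) ler_pM// ?BM//; first by rewrite exprn_ge0// ltW.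
by rewrite exprS -[leRHS]mulr1 ler_pM2l// exprn_ile1// ltW.
Qed.

End periodic_primitive.

(** * Bernoulli polynomials at {1/(xy)} and the primitive of the kernel *)

Section bernoulli.
Context {R : realType}.
Implicit Types (x y t u : R).

(** The endpoint 0, where [Kker] departs from its formula, is a null set. *)
Lemma eq_integ_pos t (f g : R -> R) : bmeas `[0, t] f -> bmeas `[0, t] g ->
  (forall y, 0 < y -> y <= t -> f y = g y) -> integ `[0, t] f = integ `[0, t] g.
Proof.
move=> bf bg fg.
have io h : bmeas `[0, t] h -> (@lebesgue_measure R).-integrable `]0, t] (EFin \o h).
  move=> bh; apply: integrableS (bmeas_integrable bh) => //.
  exact: subset_itv_oc_cc.
rewrite /integ -Rintegral_itv_obnd_cbnd ?io// -[RHS]Rintegral_itv_obnd_cbnd ?io//.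
by apply: eq_integ => y /=; rewrite in_itv/= => /andP[]; exact: fg.
Qed.

Definition bern2 u : R := u ^+ 2 - u + 6^-1.
Definition bern3 u : R := u ^+ 3 - (3 / 2) * u ^+ 2 + u / 2.

Lemma bern2_norm u : 0 <= u -> u <= 1 -> `|bern2 u| <= 1.
Proof. by move=> u0 u1; rewrite /bern2 ler_norml; apply/andP; split; nra. Qed.

Lemma bern3_norm u : 0 <= u -> u <= 1 -> `|bern3 u| <= 1.
Proof.
move=> u0 u1; have -> : bern3 u = u * ((u - 1) * (u - 2^-1)) by rewrite /bern3; field.
rewrite normrM -[leRHS]mulr1 ler_pM// ler_norml; first by apply/andP; split; lra.
by apply/andP; split; nra.
Qed.

Lemma is_derive_bern2 u : is_derive u 1 bern2 (2 * u - 1).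
Proof.
rewrite (_ : bern2 = id ^+ 2 - id + cst 6^-1); last by apply/funext.
by apply: is_derive_eq; rewrite /GRing.scale/=; ring.
Qed.

Lemma is_derive_bern3 u : is_derive u 1 bern3 (3 * bern2 u).
Proof.
rewrite (_ : bern3 = id ^+ 3 - (3 / 2) *: id ^+ 2 + 2^-1 *: id); last first.
  by apply/funext => v; rewrite /bern3 !fctE/= /GRing.scale/= [v / 2]mulrC.
have dX n := is_deriveX n (is_derive_id u (1 : R)).
apply: (is_derive_eq (is_deriveD (is_deriveB (dX 3) (is_deriveZ _ (dX 2)))
  (is_deriveZ _ (is_derive_id u 1)))).
by rewrite /GRing.scale/= /bern2; field.
Qed.

Lemma continuous_bern2 : continuous bern2.
Proof.
move=> u; apply: differentiable_continuous.
by apply/derivable1_diffP; case: (is_derive_bern2 u).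
Qed.

Lemma continuous_bern3 : continuous bern3.
Proof.
move=> u; apply: differentiable_continuous.
by apply/derivable1_diffP; case: (is_derive_bern3 u).
Qed.

Lemma frac_inv01 x y : 0 <= frac_inv x y /\ frac_inv x y <= 1.
Proof. by rewrite fracpart_ge0 ltW// fracpart_lt1. Qed.

Lemma bmeas_frac (C : R -> R) x t n : t <= 1 -> continuous C ->
  (forall u, 0 <= u -> u <= 1 -> `|C u| <= 1) ->
  bmeas `[0, t] (fun y => y ^+ n * C (frac_inv x y)).
Proof.
move=> t1 cC C1; split.
  apply: measurable_funTS; apply: measurable_funM; first exact: exprn_measurable.
  apply: (measurableT_comp (continuous_measurable_fun cC)).
  exact: (measurable_sectionl _ measurable_frac_inv2).
exists 1 => y /=; rewrite in_itv/= => /andP[y0 yt].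
rewrite normrM -[leRHS]mulr1 ler_pM ?C1 ?(frac_inv01 _ _).1 ?(frac_inv01 _ _).2//.
by rewrite ger0_norm ?exprn_ge0// exprn_ile1//; exact: le_trans t1.
Qed.

(** Integrating the derivative of y^3 B_3({1/(xy)}) expresses this integral as x times a combination
    of two terms, each at most t^3. The oscillation thus gains a factor of order xt over the trivial
    bound. *)
Lemma integ_bern2_le x t : 0 < x -> x <= 1 -> 0 < t -> t <= 1 ->
  `|integ `[0, t] (fun y => y * bern2 (frac_inv x y))| <= 2 * x * t ^+ 3.
Proof.
move=> x0 x1 t0 t1.
have c3 : continuous (fun u : R => 3 * bern2 u).
  move=> u; apply: (@continuous_comp _ _ _ bern2 ( *%R 3)); first exact: continuous_bern2.
  exact: mulrl_continuous.
have b2 : bmeas `[0, t] (fun y => y * bern2 (frac_inv x y)).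
  exact: (bmeas_frac x 1 t1 continuous_bern2 bern2_norm).
have b3 := bmeas_frac x 2 t1 continuous_bern3 bern3_norm.
have : integ `[0, t] (fun y => 3 * (y ^+ 2 * bern3 (frac_inv x y))
    - 3 / x * (y * bern2 (frac_inv x y))) = t ^+ 3 * bern3 (frac_inv x t).
  (* The exponent is [1.+2 = 3], and 3 bounds both B_3 and its derivative 3 B_2 on the unit
     interval. *)
  have P := @integ_periodic _ x 3 1 bern3 _ x0 x1 is_derive_bern3 c3.
  rewrite -P//.
  - by apply: eq_integ => y _; rewrite expr1; ring.
  - by rewrite /bern3; field.
  - by move=> u u0 u1; apply: le_trans (bern3_norm u0 u1) _; lra.
  - by move=> u u0 u1; rewrite normrM normr_nat ger_pMr ?bern2_norm.
rewrite integ_sub ?integ_scale//; [|by apply: bmeas_mul => //; exact: bmeas_cst..].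
set I3 := integ _ (fun y => y ^+ 2 * _); set I2 := integ _ _ => E.
have -> : I2 = x * (I3 - t ^+ 3 * bern3 (frac_inv x t) / 3).
  by rewrite -E; field; rewrite gt_eqF.
rewrite normrM gtr0_norm// [2 * x]mulrC -[leRHS]mulrA ler_pM2l//.
have /andP[] : - t ^+ 3 <= I3 <= t ^+ 3.
  rewrite -ler_norml exprSr -[X in _ * X]subr0.
  apply: norm_integ_le_cst => //; first exact: ltW.
    by case: b3.
  move=> y y0 yt; rewrite normrM normrX ger0_norm// -[leRHS]mulr1.
  have [u0 u1] := frac_inv01 x y.
  by rewrite ler_pM ?bern3_norm ?exprn_ge0// lerXn2r// nnegrE ltW.
have /andP[] : - t ^+ 3 <= t ^+ 3 * bern3 (frac_inv x t) <= t ^+ 3.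
  have [u0 u1] := frac_inv01 x t.
  by rewrite -ler_norml normrM normrX gtr0_norm// ger_pMr ?exprn_gt0// bern3_norm.
by rewrite ler_norml => ? ? ? ?; apply/andP; split; lra.
Qed.

Lemma bmeas_Kker x (D : set R) : bmeas D (Kker x).
Proof.
split; last by exists 2^-1 => y _; exact: Kker_norm.
by apply: measurable_funTS; exact: (measurable_sectionl _ measurable_Kker2).
Qed.

(** The derivative of y^2 B_2({1/(xy)}) is 2 y B_2 - 2 B_1/x, and K = -B_1. The boundary term is the
    leading one; the other is O(x^2 t^3) by [integ_bern2_le]. *)
Lemma integ_Kker x t : 0 < x -> x <= 1 -> 0 < t -> t <= 1 ->
  integ `[0, t] (Kker x) = x * t ^+ 2 * bern2 (frac_inv x t) / 2
    - x * integ `[0, t] (fun y => y * bern2 (frac_inv x y)).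
Proof.
move=> x0 x1 t0 t1.
have c2 : continuous (fun u : R => 2 * u - 1).
  by move=> u; apply: cvgB; [exact: mulrl_continuous|exact: cvg_cst].
have b2 : bmeas `[0, t] (fun y => y * bern2 (frac_inv x y)).
  exact: (bmeas_frac x 1 t1 continuous_bern2 bern2_norm).
have n1 u : 0 <= u -> u <= 1 -> `|2 * u - 1| <= 1.
  by move=> u0 u1; rewrite ler_norml; apply/andP; split; lra.
have b1 : bmeas `[0, t] (fun y => 2 * frac_inv x y - 1).
  rewrite (_ : (fun y => _) = fun y => y ^+ 0 * (2 * frac_inv x y - 1)).
    exact: (bmeas_frac x 0 t1 c2 n1).
  by apply/funext => y; rewrite mul1r.
have : integ `[0, t] (fun y => 2 * (y * bern2 (frac_inv x y))
    - x^-1 * (2 * frac_inv x y - 1)) = t ^+ 2 * bern2 (frac_inv x t).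
  have P := @integ_periodic _ x 1 0 bern2 _ x0 x1 is_derive_bern2 c2.
  rewrite -P//.
  - by apply: eq_integ => y _; rewrite expr1 expr0; ring.
  - by rewrite /bern2; field.
  - exact: bern2_norm.
rewrite integ_sub ?integ_scale//; [|by apply: bmeas_mul => //; exact: bmeas_cst..].
rewrite (@eq_integ_pos t (Kker x) (fun y => - 2^-1 * (2 * frac_inv x y - 1))).
- rewrite integ_scale// => E.
  rewrite (_ : x * t ^+ 2 * _ = x * (t ^+ 2 * bern2 (frac_inv x t))); last by ring.
  by rewrite -E; field; rewrite gt_eqF.
- exact: bmeas_Kker.
- by apply: bmeas_mul => //; exact: bmeas_cst.
- by move=> y y0 yt; rewrite Kker_pos//; field.
Qed.

(** The boundary term of [integ_Kker] contributes at most x t^2, the other at most 2 x^2 t^3 <= 2 x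
    t^2. *)
Lemma integ_Kker_le x t : 0 < x -> x <= 1 -> 0 <= t -> t <= 1 ->
  `|integ `[0, t] (Kker x)| <= 3 * x * t ^+ 2.
Proof.
move=> x0 x1 + t1; rewrite le_eqVlt => /predU1P[<-|t0].
  by rewrite /integ set_itv1 Rintegral_set1 normr0 expr0n/= mulr0.
rewrite integ_Kker//; apply: le_trans (ler_normB _ _) _.
rewrite (_ : 3 * x * t ^+ 2 = x * t ^+ 2 + 2 * x * t ^+ 2); last by ring.
have [u0 u1] := frac_inv01 x t; have xt : 0 < x * t ^+ 2 by rewrite mulr_gt0 ?exprn_gt0.
apply: lerD.
  have /ler_normlP[] := bern2_norm u0 u1.
  by rewrite -mulrA normrM gtr0_norm// ger_pMr// ler_norml => ? ?; apply/andP; split; lra.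
rewrite normrM gtr0_norm//.
apply: le_trans (ler_wpM2l (ltW x0) (integ_bern2_le x0 x1 t0 t1)) _.
rewrite (_ : x * _ = 2 * x * t ^+ 2 * (x * t)); last by ring.
by rewrite -[leRHS]mulr1 ler_wpM2l ?mulr_ile1// ?mulr_ge0 ?exprn_ge0 // ltW.
Qed.

End bernoulli.

(** * Integration against the kernel *)

Section pairing.
Context {R : realType}.
Notation mR := (measurableTypeR R).
Implicit Types (a b t y : R).

(** The floor counts the positive integers up to [a]. Applied to 1/(yz), it writes the jumps of the
    kernel as a finite sum of indicators. *)
Lemma floor_sum (a : R) (N : nat) : 0 <= a -> a <= N%:R ->
  (Num.floor a)%:~R = \sum_(i < N) (i.+1%:R <= a)%R%:R :> R.
Proof.
move=> a0; pose m := Num.truncn a.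
have /andP[ma am] := truncn_itv a0.
have -> : (Num.floor a)%:~R = m%:R :> R.
  rewrite (@floor_def _ a m%:Z)//; rewrite intrD1; apply/andP; split => //.
  by rewrite -natr1 in am.
move=> aN; have mN : (m <= N)%N by rewrite -(ler_nat R); exact: le_trans aN.
have lem (i : nat) : (i.+1%:R <= a)%R = (i < m)%N.
  apply/idP/idP => [ia|im]; last by apply: le_trans ma; rewrite ler_nat.
  by rewrite -ltnS -(ltr_nat R); exact: le_lt_trans am.
under eq_bigr do rewrite lem.
rewrite -(big_mkord xpredT (fun i => (i < m)%N%:R)) (big_cat_nat (leq0n m) mN)//=.
rewrite [X in _ + X]big1_seq ?addr0; last first.
  by move=> i /=; rewrite mem_index_iota => /andP[mi _]; rewrite ltnNge mi.
rewrite big_nat (eq_bigr (fun=> 1)); last by move=> i /andP[_ ->].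
by rewrite -big_nat big_const_nat subn0 iter_addr_0.
Qed.

Lemma integ_restrictl (a b c : R) (f : R -> R) : a <= c ->
  integ `[a, b] (fun x => (c <= x)%R%:R * f x) = integ `[c, b] f.
Proof.
move=> ac.
have -> : (`[c, b] = `[a, b] `&` [set x | c <= x])%classic.
  apply/seteqP; split => x /=; rewrite !in_itv/=.
    by move=> /andP[cx ->]; rewrite cx (le_trans ac cx).
  by move=> [/andP[_ ->] ->].
rewrite /integ Rintegral_mkcondr; apply: eq_integ => x _.
rewrite patchE; case: ifPn => [/set_mem/= ->|]; first by rewrite mul1r.
by rewrite notin_setE/= => /negP/negbTE ->; rewrite mul0r.
Qed.

Lemma measurable_natr_bool d (T : measurableType d) (b : T -> bool) :
  measurable_fun setT b -> measurable_fun setT (fun p => (b p)%:R : R).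
Proof.
move=> mb; rewrite (_ : (fun p => _) = fun p => if b p then 1 else 0 : R).
  by apply: measurable_fun_if => //; exact: measurable_cst.
by apply/funext => p; case: (b p).
Qed.

(** With s = 1 + Nz, the new term 1/(s+z)^2 is at most 1/(s(s+z)) = (1/s - 1/(s+z))/z, and the sum
    telescopes. *)
Lemma sum_sqrV_le (z : R) (N : nat) : 0 < z ->
  \sum_(i < N) ((1 + i.+1%:R * z) ^+ 2)^-1 <= z^-1 * (1 - (1 + N%:R * z)^-1).
Proof.
move=> z0; elim: N => [|N IH]; first by rewrite big_ord0 mul0r addr0 invr1 subrr mulr0.
rewrite big_ord_recr/=; apply: le_trans (lerD IH (lexx _)) _.
set s := 1 + N%:R * z; have s0 : 0 < s by rewrite ltr_pwDl// mulr_ge0// ltW.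
have -> : 1 + N.+1%:R * z = s + z by rewrite /s -natr1; ring.
have sz0 : 0 < s + z by rewrite addr_gt0.
rewrite -lerBrDl -mulrBr (_ : _ - _ - _ = s^-1 - (s + z)^-1); last by ring.
rewrite (_ : _ * _ = (s * (s + z))^-1); last by field; rewrite !gt_eqF.
by rewrite lef_pV2 ?posrE ?exprn_gt0 ?mulr_gt0// expr2 ler_pM2r// lerDl ltW.
Qed.

Variables (f : R -> R) (A S : R).
Hypothesis mf : measurable_fun setT f.
Hypothesis fS : forall y, 0 <= y -> y <= 1 -> `|f y| <= S.
Hypothesis fA : forall t, 0 <= t -> t <= 1 -> `|integ `[0, t] f| <= A * t ^+ 2.

Let A_ge0 : 0 <= A.
Proof. by have := fA ler01 (lexx 1); rewrite expr1n mulr1; exact: le_trans. Qed.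

Let S_ge0 : 0 <= S.
Proof. by have := fS ler01 (lexx 1); exact: le_trans. Qed.

Let bf a b : 0 <= a -> b <= 1 -> bmeas `[a, b] f.
Proof.
move=> a0 b1; split; first exact: measurable_funTS.
by exists S => y /=; rewrite in_itv/= => /andP[ay yb]; apply: fS; lra.
Qed.

Section cut.
Variable e : R.
Hypotheses (e_gt0 : 0 < e) (e_le1 : e <= 1).

Let W_le t : e <= t -> t <= 1 -> `|integ `[e, t] f| <= 2 * A * t ^+ 2.
Proof.
move=> et t1; have t0 : 0 <= t by have := e_gt0; lra.
have -> : integ `[e, t] f = integ `[0, t] f - integ `[0, e] f.
  by rewrite (@integ_split _ 0 e t)//; [ring|exact: ltW|exact: bf].
apply: le_trans (ler_normB _ _) _.
rewrite (_ : 2 * A * t ^+ 2 = A * t ^+ 2 + A * t ^+ 2); last by ring.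
apply: lerD; first exact: fA.
apply: le_trans (fA (ltW e_gt0) e_le1) _.
by rewrite ler_wpM2l// lerXn2r// nnegrE ltW.
Qed.

Lemma bmeas_invX n b : bmeas `[e, b] (fun y : R => (y ^+ n)^-1).
Proof.
split.
  apply: measurable_funTS; apply: (measurableT_comp measurable_inv).
  exact: exprn_measurable.
exists (e ^+ n)^-1 => y /=; rewrite in_itv/= => /andP[ey _].
have y0 : 0 < y by have := e_gt0; lra.
rewrite gtr0_norm ?invr_gt0 ?exprn_gt0// lef_pV2 ?posrE ?exprn_gt0//.
by rewrite lerXn2r// nnegrE ltW.
Qed.

(* Fubini applied to 1/y = 1 + \int_y^1 dt/t^2. *)
Lemma integ_divr_id_le : `|integ `[e, 1] (fun y => f y / y)| <= 4 * A.
Proof.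
pose g (y t : R) := (y <= t)%R%:R * (f y * (t ^+ 2)^-1).
have mg : measurable_fun setT (fun p : mR * mR => g p.1 p.2).
  apply: measurable_funM.
    apply: measurable_natr_bool; apply: measurable_fun_ler.
      exact: measurable_fst.
    exact: measurable_snd.
  apply: measurable_funM; first exact: (measurableT_comp mf measurable_fst).
  apply: (measurableT_comp measurable_inv).
  exact: (measurableT_comp (exprn_measurable _) measurable_snd).
have gM (y t : R) : e <= y -> y <= 1 -> e <= t -> t <= 1 -> `|g y t| <= S * (e ^+ 2)^-1.
  move=> ey y1 et t1; have t0 : 0 < t by have := e_gt0; lra.
  have y0 : 0 <= y by have := e_gt0; lra.
  rewrite /g normrM -[leRHS]mul1r ler_pM//; first by case: (y <= t); rewrite ?normr0 ?normr1.
  rewrite normrM ler_pM ?fS// gtr0_norm ?invr_gt0 ?exprn_gt0//.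
  by rewrite lef_pV2 ?posrE ?exprn_gt0// lerXn2r// nnegrE ltW.
have E1 (y : R) : e <= y -> y <= 1 -> integ `[e, 1] (g y) = f y / y - f y.
  move=> ey y1; rewrite integ_restrictl// integ_scale; last first.
    exact: (bmeas_itv ey (lexx _) (bmeas_invX 2 1)).
  have -> : integ `[y, 1] (fun t : R => (t ^+ 2)^-1) = - 1^-1 - - y^-1.
    apply: (@integ_ftc _ _ (fun t => - t^-1)) => // t yt t1;
      have t0 : t != 0 by rewrite gt_eqF//; have := e_gt0; lra.
    - have dV := is_deriveN (is_deriveV t0 (is_derive_id t 1)).
      by apply: (is_derive_eq dV); rewrite /GRing.scale/=; ring.
    - by apply: continuousV; [rewrite expf_neq0|exact: exprn_continuous].
  by rewrite invr1; ring.
have E2 (t : R) : e <= t -> t <= 1 ->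
    integ `[e, 1] (g ^~ t) = (t ^+ 2)^-1 * integ `[e, t] f.
  move=> et t1; rewrite /g integ_restrict// -integ_scale; last by apply: bf => //; exact: ltW.
  by apply: eq_integ => y _; rewrite mulrC.
have bdiv : bmeas `[e, 1] (fun y => f y / y).
  apply: bmeas_mul; first by apply: bf => //; exact: ltW.
  exact: (bmeas_invX 1 1).
have : integ `[e, 1] (fun y => f y / y - f y) =
    integ `[e, 1] (fun t => integ `[e, 1] (g ^~ t)).
  rewrite -(integ_fubini mg gM); apply: eq_integ => y /=.
  by rewrite in_itv/= => /andP[ey y1]; rewrite E1.
rewrite integ_sub//; last by apply: bf => //; exact: ltW.
move/(canRL (subrK _)) => ->; apply: le_trans (ler_normD _ _) _.
(* One 2A bounds the integral over t of t^(-2) times the primitive of [f] from [e]; the other bounds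
   that primitive at 1. *)
have -> : 4 * A = 2 * A + 2 * A * 1 ^+ 2 by ring.
apply: lerD; last exact: W_le.
apply: (@le_trans _ _ (2 * A * (1 - e))); last first.
  by rewrite -[leRHS]mulr1 ler_wpM2l ?mulr_ge0//; have := e_gt0; lra.
apply: norm_integ_le_cst => //.
  have mg' : measurable_fun setT (fun p : mR * mR => g p.2 p.1).
    exact: (measurableT_comp mg (@measurable_swap _ _ _ _)).
  have [] := @bmeas_integ _ e 1 e 1 (S * (e ^+ 2)^-1) (fun t y => g y t) mg' _ => //.
  by move=> *; exact: gM.
move=> t et t1; rewrite E2// normrM; have t0 : 0 < t by have := e_gt0; lra.
rewrite gtr0_norm ?invr_gt0 ?exprn_gt0// mulrC ler_pdivrMr ?exprn_gt0//.
exact: W_le.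
Qed.

(* The cut at e = 1/((N+1)z) makes f(y)/(yz) integrable and the jumps of K(.,z) finite in
   number. *)
Lemma integ_cut_le (z : R) (N : nat) : 0 < z -> z <= 1 -> e = (N.+1%:R * z)^-1 ->
  `|integ `[e, 1] (fun y => f y * Kker y z)| <= 13 * A / z.
Proof.
move=> z0 z1 eE; have e0 := ltW e_gt0.
pose c (i : nat) := (i.+1%:R * z)^-1.
have bfe := bf e0 (lexx 1).
have bdiv : bmeas `[e, 1] (fun y => f y / y).
  by apply: bmeas_mul => //; exact: (bmeas_invX 1 1).
have bind (i : nat) : bmeas `[e, 1] (fun y => (y <= c i)%R%:R * f y).
  apply: bmeas_mul => //; split.
    apply: measurable_funTS; apply: measurable_natr_bool; apply: measurable_fun_ler;
      [exact: measurable_id|exact: measurable_cst].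
  by exists 1 => y _; case: (y <= c i); rewrite ?normr0 ?normr1.
(* floor(1/(yz)) counts the i < N+1 with y <= 1/((i+1)z). *)
have KE y : e <= y -> y <= 1 -> f y * Kker y z = 2^-1 * f y - z^-1 * (f y / y)
    + \sum_(i < N.+1) (y <= c i)%R%:R * f y.
  move=> ey y1; have y0 : 0 < y by have := e_gt0; lra.
  have yz0 : 0 < y * z by rewrite mulr_gt0.
  rewrite Kker_pos// /frac_inv /fracpart (@floor_sum _ N.+1); first last.
  - rewrite invf_ple ?posrE ?ltr0Sn// -ler_pdivrMr//.
    by rewrite -invfM mulrC; move: ey; rewrite eE mulrC.
  - by rewrite invr_ge0 ltW.
  rewrite -mulr_suml (eq_bigr (fun i : 'I_N.+1 => (y <= c i)%R%:R)).
    by field; rewrite !gt_eqF.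
  move=> i _; congr (nat_of_bool _)%:R.
  rewrite /c -[(y * z)^-1]mul1r ler_pdivlMr// mulrCA.
  by rewrite -[(_ * z)^-1]mul1r ler_pdivlMr ?mulr_gt0 ?ltr0Sn.
have -> : integ `[e, 1] (fun y => f y * Kker y z) =
    2^-1 * integ `[e, 1] f - z^-1 * integ `[e, 1] (fun y => f y / y)
    + \sum_(i < N.+1) integ `[e, 1] (fun y => (y <= c i)%R%:R * f y).
  rewrite -integ_sum// -!integ_scale// -integ_sub;
    [|by apply: bmeas_mul => //; exact: bmeas_cst..].
  rewrite -integ_add.
  - by apply: eq_integ => y /=; rewrite in_itv/= => /andP[]; exact: KE.
  - by apply: bmeas_add; [|apply: bmeas_opp]; apply: bmeas_mul => //; exact: bmeas_cst.
  - exact: bmeas_sum.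
have zV : 1 <= z^-1 by rewrite invf_ge1.
(* A/z is for the constant 1/2 of the kernel, 4A/z for the term 1/(yz), and 8A/z for the jumps. *)
have -> : 13 * A / z = A / z + 4 * A / z + 8 * A / z by field; rewrite gt_eqF.
apply: le_trans (ler_normD _ _) _; apply: lerD.
  apply: le_trans (ler_normB _ _) _; apply: lerD.
    rewrite normrM ger0_norm ?invr_ge0//.
    have /(_ 1 e_le1 (lexx 1)) := W_le; rewrite expr1n mulr1 => W1.
    by apply: (@le_trans _ _ A); [lra|rewrite ler_peMr].
  rewrite normrM gtr0_norm ?invr_gt0// mulrC ler_pM2r ?invr_gt0//.
  exact: integ_divr_id_le.
apply: le_trans (ler_norm_sum _ _ _) _.
(* min(1, 1/s^2) <= 4/(1+s)^2, and the sum of the latter telescopes. *)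
apply: (@le_trans _ _ (\sum_(i < N.+1) 8 * A * ((1 + i.+1%:R * z) ^+ 2)^-1)); last first.
  rewrite -mulr_sumr ler_wpM2l ?mulr_ge0//.
  apply: le_trans (sum_sqrV_le _ z0) _.
  rewrite -[leRHS]mulr1 ler_pM2l ?invr_gt0//.
  by rewrite gerBl invr_ge0 addr_ge0// mulr_ge0// ltW.
apply: ler_sum => i _.
have s0 : 0 < i.+1%:R * z by rewrite mulr_gt0 ?ltr0Sn.
have s1 : 0 < 1 + i.+1%:R * z by rewrite addr_gt0.
(* Put s = (i+1)z, so c_i = 1/s. If s >= 1, the jump lies in [[e, 1]] and 1 + s <= 2s; if s < 1, the
   indicator is 1 on all of [[e, 1]] and (1+s)^2 <= 4. *)
have [ci1|ci1] := leP (c i) 1.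
  have eci : e <= c i.
    by rewrite eE lef_pV2 ?posrE ?mulr_gt0 ?ltr0Sn// ler_pM2r// ler_nat.
  rewrite integ_restrict//; apply: le_trans (W_le eci ci1) _.
  suff H : c i ^+ 2 <= 4 * ((1 + i.+1%:R * z) ^+ 2)^-1.
    by have := ler_wpM2l A_ge0 H; lra.
  rewrite invf_le1 in ci1 => //.
  rewrite /c exprVn ler_pdivlMr ?exprn_gt0// mulrC ler_pdivrMr ?exprn_gt0//.
  by move: (i.+1%:R * z) s0 ci1 {s1} => s s0 s1; nra.
rewrite (@eq_integ _ _ _ f); last first.
  move=> y /=; rewrite in_itv/= => /andP[_ y1].
  by rewrite (le_trans y1 (ltW ci1)) mul1r.
apply: le_trans (W_le e_le1 (lexx 1)) _; rewrite expr1n mulr1.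
rewrite invf_gt1 in ci1 => //.
rewrite ler_pdivlMr ?exprn_gt0//.
have H : (1 + i.+1%:R * z) ^+ 2 <= 4.
  by move: (i.+1%:R * z) s0 ci1 {s1} => s s0 s1; nra.
by have := ler_wpM2l A_ge0 H; lra.
Qed.

End cut.

(** The part below the cut e = 1/((n+1)z) costs at most S e, which vanishes as n grows. Hence the
    sup bound [S] does not enter the estimate. Taking n at least the floor of 1/z ensures e <= 1. *)
Lemma integ_mul_Kker_le (z : R) : 0 < z -> z <= 1 ->
  `|integ `[0, 1] (fun y => f y * Kker y z)| <= 13 * A / z.
Proof.
move=> z0 z1; apply: (@ler_add_natV _ _ _ (S / z) (Num.truncn z^-1)) => n zn.
pose e := (n.+1%:R * z)^-1.
have e0 : 0 < e by rewrite invr_gt0 mulr_gt0 ?ltr0Sn.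
have e1 : e <= 1.
  rewrite invf_le1 ?mulr_gt0 ?ltr0Sn// -ler_pdivrMr// mul1r.
  by apply/ltW/(lt_le_trans (truncnS_gt _)); rewrite ler_nat.
have bfK : bmeas `[0, 1] (fun y => f y * Kker y z).
  apply: bmeas_mul; first exact: bf.
  rewrite (_ : (fun y => Kker y z) = Kker z); first exact: bmeas_Kker.
  by apply/funext => y; rewrite KkerC.
rewrite (@integ_split _ 0 e 1)//; last exact: ltW.
rewrite addrC; apply: le_trans (ler_normD _ _) _; apply: lerD.
  exact: (@integ_cut_le e e0 e1 z n).
have -> : S / z / n.+1%:R = S * (e - 0).
  by rewrite /e subr0; field; rewrite !gt_eqF.
apply: norm_integ_le_cst; first exact: ltW.
  by case: (bmeas_itv (lexx 0) e1 bfK).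
move=> y y0 ye; rewrite normrM -[leRHS]mulr1 ler_pM// ?fS//; first exact: le_trans e1.
by apply: le_trans (Kker_norm _ _) _; lra.
Qed.

End pairing.

(** * Eigenfunctions *)

Section log_integrals.
Context {R : realType}.
Variable x : R.
Hypotheses (x_gt0 : 0 < x) (x_le1 : x <= 1).

Lemma integ_inv : integ `[x, 1] (fun z => z^-1) = - ln x.
Proof.
have -> : - ln x = ln 1 - ln x by rewrite ln1 sub0r.
apply: integ_ftc => // z xz z1; have z0 : 0 < z by exact: lt_le_trans xz.
  exact: is_derive1_ln.
by apply: inv_continuous; rewrite gt_eqF.
Qed.

Lemma bmeas_1Bln : bmeas `[x, 1] (fun z : R => 1 - ln z).
Proof.
apply: bmeas_add; first exact: bmeas_cst.
apply: bmeas_opp; split; first by apply: measurable_funTS; exact: measurable_ln.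
exists (- ln x) => z /=; rewrite in_itv/= => /andP[xz z1].
have z0 : 0 < z by exact: lt_le_trans xz.
by rewrite ler0_norm ?ln_le0// lerN2 ler_ln ?posrE.
Qed.

(** The logarithm is integrable at 0, so the bound is uniform in [x]; this later makes [J]
    bounded. *)
Lemma integ_1Bln : integ `[x, 1] (fun z => 1 - ln z) <= 2.
Proof.
have -> : integ `[x, 1] (fun z => 1 - ln z) = (2 * 1 - 1 * ln 1) - (2 * x - x * ln x).
  apply: (@integ_ftc _ _ (fun z => 2 * z - z * ln z)) => // z xz z1;
    have z0 : 0 < z by exact: lt_le_trans xz.
  - have dl := is_derive1_ln z0.
    have dM := is_deriveM (is_derive_id z 1) dl.
    have dZ := is_deriveZ 2 (is_derive_id z 1).
    apply: (is_derive_eq (is_deriveB dZ dM)); rewrite /GRing.scale/=.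
    by field; rewrite gt_eqF.
  - by apply: continuousB; [exact: cst_continuous|exact: continuous_ln].
have lx : ln x <= 0 by exact: ln_le0.
have := x_gt0; rewrite ln1; nra.
Qed.

End log_integrals.

(** * Decay of a bounded eigenfunction at 0 and the bound for its primitive *)

Section eigenfunction.
Context {R : realType}.
Notation mR := (measurableTypeR R).
Implicit Types (x y z t w : R).
Variables (psi : R -> R) (lam L : R).
Hypothesis LE : L = `|lam|.
Hypothesis L_ge1 : 1 <= L.
Hypothesis mpsi : measurable_fun setT psi.
Hypothesis psiL : forall y, 0 <= y -> y <= 1 -> `|psi y| <= L.
Hypothesis psiE : forall y, 0 <= y -> y <= 1 ->
  psi y = lam * integ `[0, 1] (fun z => Kker y z * psi z).

Let L_ge0 : 0 <= L. Proof. exact: le_trans L_ge1. Qed.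

Let bpsi a b : 0 <= a -> b <= 1 -> bmeas `[a, b] psi.
Proof.
move=> a0 b1; split; first exact: measurable_funTS.
exists L => y /=; rewrite in_itv/= => /andP[ay yb].
by apply: psiL; [exact: le_trans ay|exact: le_trans b1].
Qed.

(** The weight 1/z is the one produced by [integ_mul_Kker_le]. A logarithmic and a uniform bound for
    [J] yield the two terms of the final minimum. *)
Let J x := integ `[x, 1] (fun z => `|psi z| / z).

Let bJ x : 0 < x -> bmeas `[x, 1] (fun z => `|psi z| / z).
Proof.
move=> x0; apply: bmeas_mul; last exact: (bmeas_invX x0 1 1).
by apply: bmeas_norm; apply: bpsi => //; exact: ltW.
Qed.

Section insert.
Variables (h : R -> R) (A S : R).
Hypothesis mh : measurable_fun setT h.
Hypothesis hS : forall y, 0 <= y -> y <= 1 -> `|h y| <= S.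
Hypothesis hA : forall t, 0 <= t -> t <= 1 -> `|integ `[0, t] h| <= A * t ^+ 2.

Let S_ge0 : 0 <= S.
Proof. by have := hS ler01 (lexx 1); exact: le_trans. Qed.

Let P z := integ `[0, 1] (fun y => h y * Kker y z).

Let mg : measurable_fun setT (fun p : mR * mR => h p.1 * Kker p.1 p.2).
Proof.
apply: measurable_funM; last exact: measurable_Kker2.
exact: (measurableT_comp mh measurable_fst).
Qed.

Let gS y z : 0 <= y -> y <= 1 -> `|h y * Kker y z| <= S.
Proof.
move=> y0 y1; rewrite normrM -[leRHS]mulr1 ler_pM ?hS//.
by apply: le_trans (Kker_norm _ _) _; lra.
Qed.

Let bP : bmeas `[0, 1] P.
Proof.
apply: (@bmeas_integ _ 0 1 0 1 S (fun z y => h y * Kker y z)).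
  exact: (measurableT_comp mg (@measurable_swap _ _ _ _)).
by move=> *; exact: gS.
Qed.

Let PS z : 0 <= z -> z <= 1 -> `|P z| <= S.
Proof.
move=> z0 z1; rewrite -[leRHS]mulr1 -[X in _ * X]subr0.
apply: norm_integ_le_cst => //; last by move=> y y0 y1; exact: gS.
apply: measurable_funTS.
exact: (measurableT_comp mg (pair2_measurable z)).
Qed.

(** Substituting the eigenvalue equation for [psi] and exchanging the integrals moves the kernel
    onto [h], so that cancellation in [h] can be exploited. *)
Lemma integ_eigen_insert :
  integ `[0, 1] (fun y => h y * psi y) = lam * integ `[0, 1] (fun z => P z * psi z).
Proof.
pose g y z := h y * Kker y z * psi z.
have mg' : measurable_fun setT (fun p : mR * mR => g p.1 p.2).
  by apply: measurable_funM => //; exact: (measurableT_comp mpsi measurable_snd).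
have gM y z : 0 <= y -> y <= 1 -> 0 <= z -> z <= 1 -> `|g y z| <= S * L.
  by move=> *; rewrite normrM ler_pM ?gS ?psiL.
have F := integ_fubini mg' gM.
have -> : integ `[0, 1] (fun z => P z * psi z) =
    integ `[0, 1] (fun z => integ `[0, 1] (g^~ z)).
  apply: eq_integ => z /=; rewrite in_itv/= => /andP[z0 z1].
  rewrite mulrC /P -integ_scale; first by apply: eq_integ => y _; rewrite /g mulrC.
  split; last by exists S => y /=; rewrite in_itv/= => /andP[]; exact: gS.
  by apply: measurable_funTS; exact: (measurableT_comp mg (pair2_measurable z)).
rewrite -F -integ_scale; last exact: (bmeas_integ mg' gM).
apply: eq_integ => y /=; rewrite in_itv/= => /andP[y0 y1].
rewrite psiE// mulrCA -integ_scale; last first.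
  by apply: bmeas_mul; [exact: bmeas_Kker|exact: bpsi].
by congr (_ * _); apply: eq_integ => z _; rewrite /g mulrA.
Qed.

(** The bound 13 A/z for [P z] is poor near 0. So on [[0, x]] the trivial |P| <= S and |psi| <= L
    are used, and 13 A/z only on [[x, 1]], where it produces [J x]. *)
Lemma integ_eigen_le x : 0 < x -> x <= 1 ->
  `|integ `[0, 1] (fun y => h y * psi y)| <= L * (S * L * x + 13 * A * J x).
Proof.
move=> x0 x1; rewrite integ_eigen_insert normrM -LE ler_wpM2l//.
have bPp : bmeas `[0, 1] (fun z => P z * psi z) by apply: bmeas_mul => //; exact: bpsi.
rewrite (@integ_split _ 0 x 1)//; last exact: ltW.
apply: le_trans (ler_normD _ _) _; apply: lerD.
  rewrite -[X in _ * X]subr0; apply: norm_integ_le_cst; first exact: ltW.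
    by case: (bmeas_itv (lexx 0) x1 bPp).
  by move=> z z0 zx; rewrite normrM ler_pM ?PS ?psiL//; exact: le_trans x1.
rewrite -integ_scale; last exact: bJ.
apply: norm_integ_le; first exact: (bmeas_itv (ltW x0) _ bPp).
  by apply: bmeas_mul; [exact: bmeas_cst|exact: bJ].
move=> z xz z1; have z0 : 0 < z by exact: lt_le_trans xz.
rewrite normrM [leRHS]mulrCA mulrC ler_wpM2l//.
exact: (integ_mul_Kker_le mh hS hA z0 z1).
Qed.

End insert.

Lemma integ_norm_eigen_div_le_log x : 0 < x -> x <= 1 -> J x <= L * - ln x.
Proof.
move=> x0 x1; rewrite -integ_inv// -integ_scale; last exact: (bmeas_invX x0 1 1).
apply: le_integ; first exact: bJ.
  by apply: bmeas_mul; [exact: bmeas_cst|exact: (bmeas_invX x0 1 1)].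
move=> z xz z1; have z0 : 0 < z by exact: lt_le_trans xz.
by rewrite ler_pM2r ?invr_gt0// psiL// ltW.
Qed.

(** Apply [integ_eigen_le] to h = K(x,.), with S = 1 and A = 3x from [integ_Kker_le], so 39 = 13 *
    3; then bound [J] by L log(1/x). *)
Lemma eigen_decay x : 0 < x -> x <= 1 -> `|psi x| <= 39 * L ^+ 3 * x * (1 - ln x).
Proof.
move=> x0 x1; have x0' := ltW x0; rewrite psiE// normrM -LE.
have mK : measurable_fun setT (Kker x) by exact: (measurable_sectionl _ measurable_Kker2).
have K1 y : 0 <= y -> y <= 1 -> `|Kker x y| <= 1.
  by move=> _ _; apply: le_trans (Kker_norm _ _) _; lra.
have KA t : 0 <= t -> t <= 1 -> `|integ `[0, t] (Kker x)| <= 3 * x * t ^+ 2.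
  exact: integ_Kker_le.
have H := integ_eigen_le mK K1 KA x0 x1.
apply: le_trans (ler_wpM2l L_ge0 H) _.
have l0 : ln x <= 0 by exact: ln_le0.
have HJ := integ_norm_eigen_div_le_log x0 x1.
have : L ^+ 2 * x * J x <= L ^+ 2 * x * (L * - ln x) by rewrite ler_wpM2l ?mulr_ge0 ?exprn_ge0.
have : 0 <= L ^+ 3 * x by rewrite mulr_ge0 ?exprn_ge0.
lra.
Qed.

(** The factor z in [eigen_decay] cancels the weight 1/z, leaving 39 L^3 times an integral that is
    at most 2. *)
Lemma integ_norm_eigen_div_le x : 0 < x -> x <= 1 -> J x <= 78 * L ^+ 3.
Proof.
move=> x0 x1.
apply: (@le_trans _ _ (integ `[x, 1] (fun z => 39 * L ^+ 3 * (1 - ln z)))).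
  apply: le_integ; first exact: bJ.
    by apply: bmeas_mul; [exact: bmeas_cst|exact: bmeas_1Bln].
  move=> z xz z1; have z0 : 0 < z by exact: lt_le_trans xz.
  rewrite ler_pdivrMr//; apply: le_trans (eigen_decay z0 z1) _; lra.
rewrite integ_scale; last exact: bmeas_1Bln.
have := ler_wpM2l (_ : 0 <= 39 * L ^+ 3) (integ_1Bln x0 x1).
by rewrite mulr_ge0 ?exprn_ge0// => /(_ isT); lra.
Qed.

Lemma integ_eigen_itv_le x : 0 < x -> x <= 1 ->
  `|integ `[0, x] psi| <= 3 * L ^+ 3 * x ^+ 3 + 13 * L ^+ 2 * x ^+ 3 * J x.
Proof.
move=> x0 x1; have x0' := ltW x0.
(* [h] is the leading term of [G] according to [integ_Kker], with y as the parameter and x as the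
   upper limit. *)
pose h y := x ^+ 2 / 2 * (y * bern2 (frac_inv x y)).
pose G y := integ `[0, x] (fun w => Kker w y).
have mh : measurable_fun setT h.
  apply: measurable_funM => //; apply: measurable_funM => //.
  apply: (measurableT_comp (continuous_measurable_fun continuous_bern2)).
  exact: (measurable_sectionl _ measurable_frac_inv2).
have hS y : 0 <= y -> y <= 1 -> `|h y| <= x ^+ 2.
  move=> y0 y1; have [u0 u1] := frac_inv01 x y.
  have x2 : 0 <= x ^+ 2 by rewrite exprn_ge0.
  rewrite normrM -[leRHS]mulr1 ler_pM//; first by rewrite ger0_norm; lra.
  by rewrite normrM -[leRHS]mulr1 ler_pM ?bern2_norm// ger0_norm.
have b2 : bmeas `[0, 1] (fun y => y * bern2 (frac_inv x y)).
  exact: (bmeas_frac x 1 (lexx 1) continuous_bern2 bern2_norm).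
(* [integ_bern2_le] gives x^3 t^3, and t <= 1 reduces this to the quadratic form that
   [integ_eigen_le] requires. *)
have hA t : 0 <= t -> t <= 1 -> `|integ `[0, t] h| <= x ^+ 3 * t ^+ 2.
  rewrite le_eqVlt => /predU1P[<- _|t0 t1].
    by rewrite /integ set_itv1 Rintegral_set1 normr0 expr0n/= mulr0.
  rewrite /h integ_scale; last exact: (bmeas_itv (lexx 0) t1 b2).
  rewrite normrM ger0_norm; last by rewrite divr_ge0 ?exprn_ge0.
  have H := integ_bern2_le x0 x1 t0 t1.
  apply: le_trans (ler_wpM2l _ H) _; first by rewrite divr_ge0 ?exprn_ge0.
  rewrite (_ : x ^+ 2 / 2 * (2 * x * t ^+ 3) = x ^+ 3 * t ^+ 2 * t); last by field.
  by rewrite -[leRHS]mulr1 ler_wpM2l// mulr_ge0 ?exprn_ge0// ltW.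
have H := integ_eigen_le mh hS hA x0 x1.
have K1 w y : `|Kker w y| <= 1 by apply: le_trans (Kker_norm _ _) _; lra.
have bG : bmeas `[0, 1] G.
  apply: (@bmeas_integ _ 0 1 0 x 1 (fun y w => Kker w y)) => //.
  exact: (measurableT_comp measurable_Kker2 (@measurable_swap _ _ _ _)).
have bh : bmeas `[0, 1] h.
  by apply: bmeas_mul => //; exact: bmeas_cst.
(* The remainder -y times the integral of w B_2({1/(yw)}) over [[0, x]] is already O(x^3), so the
   trivial bound on [psi] suffices for it. *)
have Gh y : 0 <= y -> y <= 1 -> `|G y - h y| <= 2 * x ^+ 3.
  have GE : G y = integ `[0, x] (Kker y) by apply: eq_integ => w _; rewrite KkerC.
  have x3 : 0 <= x ^+ 3 by rewrite exprn_ge0.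
  rewrite le_eqVlt GE => /predU1P[<- _|y0 y1].
    rewrite /h mul0r mulr0 subr0 (@eq_integ _ _ _ (fun=> 0)).
      by rewrite integ_cst// mul0r normr0 mulr_ge0.
    by move=> w _; rewrite /Kker ltxx.
  rewrite integ_Kker// /h frac_invC (_ : _ - _ =
    - (y * integ `[0, x] (fun w => w * bern2 (frac_inv y w)))); last by field.
  rewrite normrN normrM gtr0_norm//.
  have H2 := integ_bern2_le y0 y1 x0 x1.
  apply: le_trans (ler_wpM2l (ltW y0) H2) _.
  rewrite (_ : y * (2 * y * x ^+ 3) = 2 * x ^+ 3 * (y * y)); last by ring.
  by rewrite -[leRHS]mulr1 ler_wpM2l ?mulr_ge0// mulr_ile1// ltW.
have -> : integ `[0, x] psi = lam * (integ `[0, 1] (fun y => h y * psi y)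
    + integ `[0, 1] (fun y => (G y - h y) * psi y)).
  have bp1 := bpsi (lexx 0) (lexx 1).
  rewrite -integ_add; first last.
  - by apply: bmeas_mul => //; apply: bmeas_add => //; exact: bmeas_opp.
  - exact: bmeas_mul.
  pose g w y := Kker w y * psi y.
  have mg : measurable_fun setT (fun p : mR * mR => g p.1 p.2).
    apply: measurable_funM; first exact: measurable_Kker2.
    exact: (measurableT_comp mpsi measurable_snd).
  have gM w y : 0 <= w -> w <= x -> 0 <= y -> y <= 1 -> `|g w y| <= 1 * L.
    by move=> *; rewrite normrM ler_pM ?psiL.
  rewrite (@eq_integ _ _ psi (fun w => lam * integ `[0, 1] (g w))); last first.
    move=> w /=; rewrite in_itv/= => /andP[w0 wx].
    by rewrite psiE//; exact: le_trans x1.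
  rewrite integ_scale; last exact: (bmeas_integ mg gM).
  rewrite (integ_fubini mg gM); congr (_ * _); apply: eq_integ => y _.
  rewrite /g -mulrDl addrC subrK mulrC -integ_scale.
    by apply: eq_integ => w _; rewrite mulrC.
  rewrite (_ : (fun w => Kker w y) = Kker y); first exact: bmeas_Kker.
  by apply/funext => w; rewrite KkerC.
have H3 : `|integ `[0, 1] (fun y => (G y - h y) * psi y)| <= 2 * x ^+ 3 * L.
  rewrite -[leRHS]mulr1 -[X in _ * X]subr0; apply: norm_integ_le_cst => //.
    suff [] : bmeas `[0, 1] (fun y => (G y - h y) * psi y) by [].
    apply: bmeas_mul; last exact: bpsi.
    by apply: bmeas_add => //; exact: bmeas_opp.
  by move=> y y0 y1; rewrite normrM ler_pM ?Gh ?psiL.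
rewrite normrM -LE; apply: le_trans (ler_wpM2l L_ge0 (le_trans (ler_normD _ _) (lerD H H3))) _.
(* The remainder contributes 2 L^2 x^3, which L >= 1 merges with the cubic term to give the constant
   3. *)
have : 0 <= L ^+ 2 * x ^+ 3 * (L - 1) by rewrite !mulr_ge0 ?exprn_ge0 ?subr_ge0.
lra.
Qed.

End eigenfunction.

(** * Normalized eigenfunctions *)

Section normalized_eigenfunction.
Context {R : realType}.
Variables (phi : R -> R) (lam : R).
Hypothesis phi_eigen : eigenfun phi lam.
Hypothesis phi_normal : ip phi phi = 1.
Notation mu := (@lebesgue_measure R).
Implicit Types x y z : R.

Let mphi : measurable_fun (`[0, 1] : set R) phi.
Proof. by case: phi_eigen => -[]. Qed.

Let iphi2 : mu.-integrable `[0, 1] (EFin \o (fun y => phi y ^+ 2)).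
Proof. by case: phi_eigen => -[]. Qed.

Let phiE x : 0 <= x -> x <= 1 ->
  phi x = lam * integ `[0, 1] (fun y => Kker x y * phi y).
Proof. by move=> x0 x1; case: phi_eigen => _ [_]; apply; rewrite /I01/= in_itv/= x0. Qed.

Let phi2 : integ `[0, 1] (fun y => phi y ^+ 2) = 1.
Proof. by rewrite -[RHS]phi_normal /ip /I01; apply: eq_integ => y _; rewrite expr2. Qed.

(** As |K| <= 1/2 and [phi] has norm 1, a pointwise AM-GM bound replaces Cauchy-Schwarz. The same
    majorant shows that K(x,.) phi is integrable before [phi] is known to be bounded. *)
Lemma norm_eigenfun_le x : 0 <= x -> x <= 1 -> `|phi x| <= `|lam| / 2.
Proof.
move=> x0 x1; rewrite phiE// normrM ler_wpM2l//.
have i1 : mu.-integrable `[0, 1] (EFin \o (fun=> 1 : R)).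
  by apply: bmeas_integrable; exact: bmeas_cst.
(* |K phi| <= |phi|/2 <= (1 + phi^2)/4 *)
pose b y := 4^-1 * (1 + phi y ^+ 2).
have i2 : mu.-integrable `[0, 1] (EFin \o (fun y => 1 + phi y ^+ 2)).
  by apply: eq_integrable (integrableD _ i1 iphi2).
have ib : mu.-integrable `[0, 1] (EFin \o b).
  by apply: eq_integrable (integrableZl _ 4^-1 i2).
have Kb y : `|Kker x y * phi y| <= b y.
  rewrite /b normrM; have := Kker_norm x y; have := normr_ge0 (Kker x y).
  have := normr_ge0 (phi y); rewrite -[phi y ^+ 2]real_normK ?num_real//.
  move: `|Kker x y| `|phi y| => k p p0 k0 k1.
  by have := mulr_ge0 p0 (_ : 0 <= 2^-1 - k); have := sqr_ge0 (1 - p); rewrite subr_ge0; nra.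
have iK : mu.-integrable `[0, 1] (EFin \o (fun y => Kker x y * phi y)).
  apply: le_integrable ib => //.
    apply/measurable_EFinP; apply: measurable_funM => //.
    by case: (bmeas_Kker x `[0, 1]).
  move=> y _ /=; rewrite lee_fin (ger0_norm (_ : 0 <= b y))//.
  exact: le_trans (Kb y).
apply: le_trans (le_normr_Rintegral _ iK) _ => //.
apply: (@le_trans _ _ (integ `[0, 1] b)).
  apply: le_Rintegral => //; first exact: integrable_norm.
rewrite /integ RintegralZl// RintegralD// -!/(integ _ _) phi2 integ_cst//.
lra.
Qed.

(** Squaring and integrating the sup bound gives 1 <= (|lam|/2)^2, hence even |lam| >= 2. *)
Lemma norm_eigenvalue_ge1 : 1 <= `|lam|.
Proof.
have : `|integ `[0, 1] (fun y => phi y ^+ 2)| <= (`|lam| / 2) ^+ 2 * (1 - 0).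
  apply: norm_integ_le_cst => //; first exact: measurable_funX.
  move=> y y0 y1; rewrite normrX lerXn2r// ?nnegrE ?divr_ge0//.
  exact: norm_eigenfun_le.
rewrite phi2 normr1; have := normr_ge0 lam; move: `|lam| => l; nra.
Qed.

(** Inserting J <= 78 L^3 or J <= L log(1/x) in [integ_eigen_itv_le] gives the two terms of the
    minimum; 1017 = 3 + 13 * 78. *)
Lemma integ_eigenfun_le x : 0 < x -> x <= 1 ->
  `|integ `[0, x] phi| <=
    1017 * `|lam| ^+ 3 * x ^+ 3 * Num.min (lam ^+ 2) (1 + ln x^-1).
Proof.
move=> x0 x1; have L1 := norm_eigenvalue_ge1.
(* [phi] is arbitrary outside the unit interval; its extension by zero is measurable on the whole
   line. *)
pose psi : R -> R := phi \_ `[0, 1].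
have psiphi y : 0 <= y -> y <= 1 -> psi y = phi y.
  by move=> y0 y1; rewrite /psi patchE mem_set//= in_itv/= y0.
have mpsi : measurable_fun setT psi.
  exact: (measurable_restrictT _ (measurable_itv _)).1.
have psiL y : 0 <= y -> y <= 1 -> `|psi y| <= `|lam|.
  move=> y0 y1; rewrite psiphi//; apply: le_trans (norm_eigenfun_le y0 y1) _.
  by move: L1; move: `|lam| => l; lra.
have psiE y : 0 <= y -> y <= 1 ->
    psi y = lam * integ `[0, 1] (fun z => Kker y z * psi z).
  move=> y0 y1; rewrite psiphi// phiE//; congr (_ * _).
  by apply: eq_integ => z /=; rewrite in_itv/= => /andP[z0 z1]; rewrite psiphi.
have -> : integ `[0, x] phi = integ `[0, x] psi.
  apply: eq_integ => y /=; rewrite in_itv/= => /andP[y0 yx].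
  by rewrite psiphi//; exact: le_trans x1.
have L0 := normr_ge0 lam; have x3 : 0 <= x ^+ 3 by rewrite exprn_ge0// ltW.
have l0 : ln x <= 0 by exact: ln_le0.
have P := integ_eigen_itv_le erefl L1 mpsi psiL psiE x0 x1.
have J1 := integ_norm_eigen_div_le_log mpsi psiL x0 x1.
have J2 := integ_norm_eigen_div_le erefl L1 mpsi psiL psiE x0 x1.
rewrite lnV ?posrE// -[lam ^+ 2]real_normK ?num_real//.
move: `|lam| L0 L1 P J1 J2 => L L0 L1.
move: (integ `[x, 1] _) => J P J1 J2.
apply: le_trans P _.
have Lx : 0 <= L ^+ 2 * x ^+ 3 by rewrite mulr_ge0// exprn_ge0.
have Lx3 : 0 <= L ^+ 3 * x ^+ 3 by rewrite mulr_ge0// exprn_ge0.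
rewrite /Num.min; case: ifP => _.
  have := ler_wpM2l Lx J2.
  have : 0 <= L ^+ 3 * x ^+ 3 * (L ^+ 2 - 1).
    by rewrite mulr_ge0// subr_ge0 exprn_ege1.
  lra.
have := ler_wpM2l Lx J1.
have : 0 <= L ^+ 3 * x ^+ 3 * - ln x by rewrite mulr_ge0// oppr_ge0.
lra.
Qed.

End normalized_eigenfunction.

Theorem theorem5p8 (R : realType) :
  exists C : R, 0 < C /\
  forall (phi : nat -> R -> R) (lam : nat -> R),
    max_orth_eigensystem phi lam ->
    forall (j : nat) (x : R), 0 < x -> x <= 1 ->
      `| integ `[0%R, x] (phi j) | <=
        C * `|lam j| ^+ 3 * x ^+ 3 * Num.min (lam j ^+ 2) (1 + ln x^-1).
Proof.
exists 1017%:R; split; first by rewrite ltr0n.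
move=> phi lam [eig [orth _]] j x x0 x1.
apply: (integ_eigenfun_le (eig j).1 _ x0 x1).
by rewrite orth eqxx.
Qed.
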